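(* Let $p,q\ge 1$ and let $\mathrm{d}\mu$ be a $q\times p$ matrix of measures supported on $\Delta\subseteq\mathbb{R}$ with moment matrix $\mathcal{M}$, such that for every $k\in\mathbb{N}_0$ all leading principal submatrices of the perturbed moment matrices $\mathcal{M}_L^{(k)}=\mathcal{M}(\Lambda^k)^\top$ and $\mathcal{M}_R^{(k)}=\Lambda^k\mathcal{M}$ are nonsingular. Let $T_L$ and $T_R$ be the banded recurrence matrices in the left and right normalizations, let $L_k$ and $U_k$ be the matrices associated with the left and right Christoffel transformations (defined in the context; $L_k$ is lower bidiagonal and $U_k$ upper bidiagonal, both with unit diagonal), and put $\widetilde{L}_k=\mathcal{D}^{-1}L_k\mathcal{D}$, $\widetilde{U}_k=\mathcal{D}U_k\mathcal{D}^{-1}$. Then the following bidiagonal factorizations hold: $$T_L=L_1\cdots L_p\,\mathcal{D}_L^{(p)}\mathcal{D}^{-1}\,\widetilde{U}_q\cdots\widetilde{U}_1,$$ $$T_R=\widetilde{L}_1\cdots\widetilde{L}_p\,\mathcal{D}^{-1}\mathcal{D}_R^{(q)}\,U_q\cdots U_1 .$$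
   Context: All matrices denoted by $\mathcal{M},\mathcal{L},\mathcal{U},\mathcal{D},\Lambda,T,L_j,U_j$ are semi-infinite, with rows and columns indexed by $\mathbb{N}_0=\{0,1,2,\dots\}$. Moment matrix: $\mathrm{d}\mu=(\mathrm{d}\mu_{b,a})_{1\le b\le q,\,1\le a\le p}$ is a matrix of measures supported on $\Delta\subseteq\mathbb{R}$ with finite moments of all orders. For $r\in\mathbb{N}$, $X_{[r]}(x)=[I_r,\,xI_r,\,x^2I_r,\dots]^\top$ (the semi-infinite block column with $r\times r$ blocks $I_r,xI_r,x^2I_r,\dots$). The moment matrix is $\mathcal{M}=\mathcal{M}(\mu)=\int_\Delta X_{[q]}(x)\,\mathrm{d}\mu(x)\,X_{[p]}^\top(x)$. $\Lambda$ is the shift matrix, $\Lambda_{n,n+1}=1$ and all other entries $0$. One has $\Lambda^q\mathcal{M}=\mathcal{M}(\Lambda^p)^\top$. Christoffel perturbations: let $\mathfrak{X}_{[r]}(x)$ be the $r\times r$ matrix with ones on the first superdiagonal, $x$ in the lower-left corner (last row, first column), and zeros elsewhere (for $r=1$, $\mathfrak{X}_{[1]}=x$). Put $\mathrm{d}\mu_L^{(k)}=\mathrm{d}\mu\,(\mathfrak{X}_{[p]}^k)^\top$ and $\mathrm{d}\mu_R^{(k)}=\mathfrak{X}_{[q]}^k\,\mathrm{d}\mu$ for $k\in\mathbb{N}_0$. Their moment matrices are $\mathcal{M}_L^{(k)}=\mathcal{M}(\mu_L^{(k)})=\mathcal{M}(\Lambda^k)^\top$ and $\mathcal{M}_R^{(k)}=\mathcal{M}(\mu_R^{(k)})=\Lambda^k\mathcal{M}$.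 Gauss--Borel factorizations: under the nonsingularity assumption, each of these moment matrices factors as (lower triangular)$^{-1}$(upper triangular)$^{-1}$ with nonsingular (i.e. nonzero diagonal) triangular factors. The left normalization takes the lower factor unitriangular, the right normalization takes the upper factor unitriangular; each normalized factorization is unique. $\mathcal{M}_L^{(k)}=(\mathcal{L}_L^{(k)})^{-1}(\mathcal{U}_L^{(k)})^{-1}$ is the left-normalized factorization ($\mathcal{L}_L^{(k)}$ lower unitriangular, $\mathcal{U}_L^{(k)}$ upper triangular), and $\mathcal{M}_R^{(k)}=(\mathcal{L}_R^{(k)})^{-1}(\mathcal{U}_R^{(k)})^{-1}$ is the right-normalized factorization ($\mathcal{U}_R^{(k)}$ upper unitriangular, $\mathcal{L}_R^{(k)}$ lower triangular). For $k=0$ the superscript is omitted: $\mathcal{M}=\mathcal{L}_L^{-1}\mathcal{U}_L^{-1}=\mathcal{L}_R^{-1}\mathcal{U}_R^{-1}$. Diagonal matrices: each of these moment matrices also factors uniquely as (lower unitriangular)(nonsingular diagonal)(upper unitriangular). $\mathcal{D}$, $\mathcal{D}_L^{(k)}$, $\mathcal{D}_R^{(k)}$ denote the diagonal factors for $\mathcal{M}$, $\mathcal{M}_L^{(k)}$, $\mathcal{M}_R^{(k)}$ respectively; in particular $\mathcal{M}=\mathcal{L}_L^{-1}\mathcal{D}\,\mathcal{U}_R^{-1}$. Matrices $L_k,U_k$ ($k\ge1$): $L_k$ is the lower unitriangular factor in the (unique) factorization of the upper Hessenberg matrix $(\mathcal{U}_L^{(k-1)})^{-1}\Lambda^\top$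 as (lower unitriangular)(upper triangular); $U_k$ is the upper unitriangular factor in the (unique) factorization of the lower Hessenberg matrix $\Lambda(\mathcal{L}_R^{(k-1)})^{-1}$ as (lower triangular)(upper unitriangular). A lower (upper) bidiagonal matrix has nonzero entries only on the main diagonal and the first subdiagonal (superdiagonal). Recurrence matrices: $T_L=\mathcal{L}_L\Lambda^q\mathcal{L}_L^{-1}=\mathcal{U}_L^{-1}(\Lambda^p)^\top\mathcal{U}_L$ and $T_R=\mathcal{L}_R\Lambda^q\mathcal{L}_R^{-1}=\mathcal{U}_R^{-1}(\Lambda^p)^\top\mathcal{U}_R$; they have $p$ subdiagonals and $q$ superdiagonals. *)

(* Defs.v *)
From HB Require Import structures.
From mathcomp Require Import all_boot all_order all_algebra.
From mathcomp Require Import all_classical all_reals all_analysis.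

Set Implicit Arguments.
Unset Strict Implicit.
Unset Printing Implicit Defensive.

Import Order.TTheory GRing.Theory Num.Theory.
Import numFieldNormedType.Exports.

Local Open Scope classical_set_scope.
Local Open Scope ring_scope.

(* Matrices with rows and columns indexed by nat.  Their product is *s below;
   the ring product that MathComp-Analysis puts on function types is the
   pointwise one and is never used on them. *)
Definition smx (K : Type) := nat -> nat -> K.

Definition one_smx (K : fieldType) : smx K := fun i j => (i == j)%:R.

Definition tr_smx (K : fieldType) (A : smx K) : smx K := fun i j => A j i.

(* The sum is over the k for which A i k * B k j is nonzero.  It has its
   intended meaning when these are finitely many, which is the case when A is
   row-finite or B is column-finite; it is 0 by convention otherwise. *)
Definition mul_smx (K : fieldType) (A B : smx K) : smx K :=
  fun i j => \sum_(k \in [set: nat]) A i k * B k j.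

Notation "A *s B" := (mul_smx A B)
  (at level 40, left associativity, format "A  *s  B") : ring_scope.

Definition exp_smx (K : fieldType) (A : smx K) (k : nat) : smx K :=
  iter k (mul_smx A) (one_smx K).

(* Two-sided inverse (A itself if there is none).  If A is triangular with
   nonzero diagonal entries, it exists, is unique and is triangular of the
   same kind: for A lower triangular the equation A *s B = 1 determines B row
   by row, and for A upper triangular B *s A = 1 determines B column by
   column. *)
Definition inv_smx (K : fieldType) (A : smx K) : smx K :=
  xget A [set B : smx K | A *s B = one_smx K /\ B *s A = one_smx K].

Definition lower_tri (K : fieldType) (A : smx K) : Prop :=
  forall i j : nat, (i < j)%N -> A i j = 0.

Definition upper_tri (K : fieldType) (A : smx K) : Prop :=
  forall i j : nat, (j < i)%N -> A i j = 0.

Definition unit_diag (K : fieldType) (A : smx K) : Prop :=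
  forall i : nat, A i i = 1.

Definition nonzero_diag (K : fieldType) (A : smx K) : Prop :=
  forall i : nat, A i i != 0.

Definition diagonal (K : fieldType) (A : smx K) : Prop :=
  forall i j : nat, i != j -> A i j = 0.

Definition lower_bidiagonal (K : fieldType) (A : smx K) : Prop :=
  forall i j : nat, i != j -> i != j.+1 -> A i j = 0.

Definition upper_bidiagonal (K : fieldType) (A : smx K) : Prop :=
  forall i j : nat, i != j -> j != i.+1 -> A i j = 0.

Definition leading_submx (K : fieldType) (A : smx K) (n : nat) : 'M[K]_n :=
  \matrix_(i < n, j < n) A i j.

Definition leading_nonsingular (K : fieldType) (A : smx K) : Prop :=
  forall n : nat, leading_submx A n \in unitmx.

(* The matrices selected by xget below are unique; they exist as soon as all
   leading principal submatrices of the matrix to be factored are nonsingular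
   (for hessenberg_L and hessenberg_U, those of the Christoffel
   perturbations). *)

(* The pair (L, U) of the Gauss--Borel factorization A = L^-1 U^-1,
   with L unitriangular (left normalization) or U unitriangular (right
   normalization). *)
Definition gauss_borel_left (K : fieldType) (A : smx K) : smx K * smx K :=
  xget (one_smx K, one_smx K)
    [set LU : smx K * smx K |
      [/\ lower_tri LU.1 /\ unit_diag LU.1,
          upper_tri LU.2 /\ nonzero_diag LU.2 &
          A = inv_smx LU.1 *s inv_smx LU.2]].

Definition gauss_borel_right (K : fieldType) (A : smx K) : smx K * smx K :=
  xget (one_smx K, one_smx K)
    [set LU : smx K * smx K |
      [/\ lower_tri LU.1 /\ nonzero_diag LU.1,
          upper_tri LU.2 /\ unit_diag LU.2 &
          A = inv_smx LU.1 *s inv_smx LU.2]].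

(* The diagonal factor of A = (lower unitriangular) (nonsingular diagonal)
   (upper unitriangular). *)
Definition ldu_diag (K : fieldType) (A : smx K) : smx K :=
  xget (one_smx K)
    [set D : smx K | (diagonal D /\ nonzero_diag D) /\
      exists L U : smx K,
        [/\ lower_tri L /\ unit_diag L,
            upper_tri U /\ unit_diag U &
            A = L *s D *s U]].

(* The lower unitriangular factor of
   H = (lower unitriangular) (upper triangular). *)
Definition hessenberg_L (K : fieldType) (H : smx K) : smx K :=
  xget (one_smx K)
    [set L : smx K | (lower_tri L /\ unit_diag L) /\
      exists2 U : smx K, upper_tri U & H = L *s U].

(* The upper unitriangular factor of
   H = (lower triangular) (upper unitriangular). *)
Definition hessenberg_U (K : fieldType) (H : smx K) : smx K :=
  xget (one_smx K)
    [set U : smx K | (upper_tri U /\ unit_diag U) /\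
      exists2 L : smx K, lower_tri L & H = L *s U].

Definition shift_smx (K : fieldType) : smx K := fun i j => (j == i.+1)%:R.

(* The entry in row n and column c of the block column
   X_[r](x) = [I_r, x I_r, x^2 I_r, ...]^T. *)
Definition block_monomials (R : realType) (r : nat) (x : R)
    (n : nat) (c : 'I_r) : R :=
  (n %% r == c)%N%:R * x ^+ (n %/ r).

Definition moment_smx (R : realType) (p q : nat)
    (Delta : set (measurableTypeR R))
    (mu : 'I_q -> 'I_p -> {measure set (measurableTypeR R) -> \bar R}) :
    smx R :=
  fun n m => \sum_(b < q) \sum_(a < p)
    \int[mu b a]_(x in Delta)
      (block_monomials x n b * block_monomials x m a).

Section ChristoffelFactors.
Variables (K : fieldType) (M : smx K).
Let Lambda := shift_smx K.

Definition christoffel_left (k : nat) : smx K :=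
  M *s tr_smx (exp_smx Lambda k).

Definition christoffel_right (k : nat) : smx K :=
  exp_smx Lambda k *s M.

Definition calL_left (k : nat) := (gauss_borel_left (christoffel_left k)).1.
Definition calU_left (k : nat) := (gauss_borel_left (christoffel_left k)).2.
Definition calL_right (k : nat) := (gauss_borel_right (christoffel_right k)).1.
Definition calU_right (k : nat) := (gauss_borel_right (christoffel_right k)).2.

Definition calD_left (k : nat) := ldu_diag (christoffel_left k).
Definition calD_right (k : nat) := ldu_diag (christoffel_right k).

(* L_k and U_k; meaningful for 1 <= k. *)
Definition christoffel_L (k : nat) : smx K :=
  hessenberg_L (inv_smx (calU_left k.-1) *s tr_smx Lambda).

Definition christoffel_U (k : nat) : smx K :=
  hessenberg_U (Lambda *s inv_smx (calL_right k.-1)).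

Definition recurrence_left (q : nat) : smx K :=
  let L := (gauss_borel_left M).1 in
  L *s exp_smx Lambda q *s inv_smx L.

Definition recurrence_right (q : nat) : smx K :=
  let L := (gauss_borel_right M).1 in
  L *s exp_smx Lambda q *s inv_smx L.

End ChristoffelFactors.

(* F 1 *s F 2 *s ... *s F n *)
Definition prod_incr (K : fieldType) (F : nat -> smx K) (n : nat) : smx K :=
  foldl (@mul_smx K) (one_smx K) [seq F i | i <- iota 1 n].

(* F n *s ... *s F 2 *s F 1 *)
Definition prod_decr (K : fieldType) (F : nat -> smx K) (n : nat) : smx K :=
  foldl (@mul_smx K) (one_smx K) [seq F i | i <- rev (iota 1 n)].

(* Main.v *)
Require Import Defs.
From HB Require Import structures.
From mathcomp Require Import all_boot all_order all_algebra.
From mathcomp Require Import all_classical all_reals all_analysis.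
From mathcomp Require Import zify.

Import Order.TTheory GRing.Theory Num.Theory.
Import numFieldNormedType.Exports.

Local Open Scope classical_set_scope.
Local Open Scope ring_scope.

(* The monomials X_[r](x) satisfy Lambda^r X_[r](x) = x X_[r](x), so
   Lambda^q M = M (Lambda^p)^T: the q-th right and the p-th left Christoffel
   perturbations have the same moment matrix, hence the same LDU factors.
   Comparing two consecutive Gauss--Borel factorizations gives, by uniqueness of
   LU factorizations, L_k = calL_L^(k-1) (calL_L^(k))^-1 and
   U_k = (calU_R^(k))^-1 calU_R^(k-1).  The products therefore telescope to
   L_1 ... L_p = calL_L (calL_L^(p))^-1 and U_q ... U_1 = (calU_R^(q))^-1 calU_R,
   and T_L D = calL_L (Lambda^q M) calU_R = L_1 ... L_p D_L^(p) U_q ... U_1.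
   Finally T_R = D^-1 T_L D.  Products of semi-infinite matrices are not
   associative in general; every regrouping relies on two of the three factors
   being row-finite or column-finite on the appropriate side. *)

Section SemiInfinite.
Variable K : fieldType.
Implicit Types A B C D L U V : smx K.

(** * Row- and column-finite matrices and associativity of the product *)

Definition row_finite A := forall i, exists n, forall k, (n <= k)%N -> A i k = 0.
Definition col_finite A := forall j, exists n, forall k, (n <= k)%N -> A k j = 0.

Lemma smxP A B : (forall i j, A i j = B i j) -> A = B.
Proof. by move=> AB; apply/funext => i; apply/funext => j. Qed.

Lemma tr_smxK A : tr_smx (tr_smx A) = A.
Proof. by []. Qed.

(** Any bound beyond which the terms vanish turns the finitely supported sum into an ordinary one
    over ['I_n]. The bound need not be sharp, so each caller takes the one that its triangular
    factor provides. *)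
Lemma mul_smxE n A B i j : (forall k, (n <= k)%N -> A i k * B k j = 0) ->
  (A *s B) i j = \sum_(k < n) A i k * B k j.
Proof.
move=> AB0; rewrite /mul_smx -(fsbig_widen `I_n) //=.
  by rewrite -fsbig_ord.
by move=> k [_ /= /negP]; rewrite -leqNgt => /AB0.
Qed.

Lemma tr_mul_smx A B : tr_smx (A *s B) = tr_smx B *s tr_smx A.
Proof. by apply: smxP => i j; apply: eq_fsbigr => k _; rewrite mulrC. Qed.

Lemma tr_one_smx : tr_smx (one_smx K) = one_smx K.
Proof. by apply: smxP => i j; rewrite /tr_smx /one_smx eq_sym. Qed.

Definition diag_smx (d : nat -> K) : smx K := fun i j => (i == j)%:R * d i.

Lemma mul_diag_smx d A i j : (diag_smx d *s A) i j = d i * A i j.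
Proof.
rewrite (mul_smxE i.+1) => [|k ik]; last first.
  by rewrite /diag_smx (ltn_eqF ik) !mul0r.
rewrite big_ord_recr big1 /= => [|k _]; first by rewrite /diag_smx eqxx mul1r add0r.
by rewrite /diag_smx (gtn_eqF (ltn_ord k)) !mul0r.
Qed.

Lemma mul1smx A : one_smx K *s A = A.
Proof.
apply: smxP => i j; rewrite -[RHS]mul1r -(mul_diag_smx (fun=> 1)).
by congr (mul_smx _ _ _ _); apply: smxP => *; rewrite /diag_smx mulr1.
Qed.

Lemma mulsmx1 A : A *s one_smx K = A.
Proof. by rewrite -[LHS]tr_smxK [X in tr_smx X]tr_mul_smx tr_one_smx mul1smx. Qed.

(** Row [i] of [A] involves only finitely many rows of [B], so the bounds given for those rows have
    a maximum. The double sum is then finite in both indices and may be exchanged. *)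
Lemma mul_smxA_fin A B C : row_finite A ->
  (forall k j, exists n, forall m, (n <= m)%N -> B k m * C m j = 0) ->
  A *s (B *s C) = A *s B *s C.
Proof.
move=> rfA finBC; apply: smxP => i j.
have [n An] := rfA i.
have [N BCN] : exists N, forall k : nat, (k < n)%N -> forall m : nat, (N <= m)%N ->
    B k m * C m j = 0.
  have /choice[f fP] : forall k, exists N, forall m, (N <= m)%N -> B k m * C m j = 0.
    by move=> k; exact: finBC.
  exists (\max_(k < n) f k) => k kn m fm; apply: fP.
  by rewrite (leq_trans _ fm)// (leq_bigmax (Ordinal kn)).
have ABE m : (A *s B) i m = \sum_(k < n) A i k * B k m.
  by apply: mul_smxE => k /An ->; rewrite mul0r.
rewrite (mul_smxE n) => [|k /An ->]; last by rewrite mul0r.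
rewrite (mul_smxE N) => [|m Nm]; last first.
  rewrite ABE mulr_suml big1// => k _.
  by rewrite -mulrA BCN ?mulr0.
under eq_bigr => k _ do rewrite (mul_smxE N _ _ _ _ (BCN _ (ltn_ord k))) mulr_sumr.
rewrite exchange_big; apply: eq_bigr => m _; rewrite ABE mulr_suml.
by apply: eq_bigr => k _; rewrite mulrA.
Qed.

Lemma mul_smxA_rr A B C : row_finite A -> row_finite B ->
  A *s (B *s C) = A *s B *s C.
Proof.
move=> rfA rfB; apply: mul_smxA_fin => // k j.
by have [n Bn] := rfB k; exists n => m /Bn ->; rewrite mul0r.
Qed.

Lemma mul_smxA_rc A B C : row_finite A -> col_finite C ->
  A *s (B *s C) = A *s B *s C.
Proof.
move=> rfA cfC; apply: mul_smxA_fin => // k j.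
by have [n Cn] := cfC j; exists n => m /Cn ->; rewrite mulr0.
Qed.

Lemma mul_smxA_cc A B C : col_finite B -> col_finite C ->
  A *s (B *s C) = A *s B *s C.
Proof.
(* Transposing twice is the identity by conversion, so the goal can be read as an equality of
   transposes. Transposition turns column-finite factors into row-finite ones in reverse order. *)
move=> cfB cfC; apply: (congr1 (@tr_smx K) (x := tr_smx _) (y := tr_smx _)).
by rewrite !tr_mul_smx (mul_smxA_rr (tr_smx C) (tr_smx B) _ cfC cfB).
Qed.

Lemma row_finite_mul A B : row_finite A -> row_finite B -> row_finite (A *s B).
Proof.
move=> rfA rfB i; have [n An] := rfA i; have /choice[f fP] := rfB.
exists (\max_(k < n) f k) => j fj.
rewrite (mul_smxE n) => [|k /An ->]; last by rewrite mul0r.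
rewrite big1// => k _; rewrite fP ?mulr0//.
by rewrite (leq_trans _ fj)// (leq_bigmax k).
Qed.

Lemma col_finite_mul A B : col_finite A -> col_finite B -> col_finite (A *s B).
Proof.
move=> cfA cfB; change (row_finite (tr_smx (A *s B))).
by rewrite tr_mul_smx; apply: row_finite_mul.
Qed.

(** * Triangular and diagonal matrices *)

Lemma row_finite_lower A : lower_tri A -> row_finite A.
Proof. by move=> lA i; exists i.+1 => k /lA. Qed.

Lemma col_finite_upper A : upper_tri A -> col_finite A.
Proof. by move=> uA i; exists i.+1 => k /uA. Qed.

Lemma row_finite_diag A : Defs.diagonal A -> row_finite A.
Proof. by move=> dA; apply: row_finite_lower => i j ij; rewrite dA// (ltn_eqF ij). Qed.

Lemma col_finite_diag A : Defs.diagonal A -> col_finite A.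
Proof. by move=> dA; apply: col_finite_upper => i j ij; rewrite dA// (gtn_eqF ij). Qed.

Lemma lower_tri_one : lower_tri (one_smx K).
Proof. by move=> i j ij; rewrite /one_smx (ltn_eqF ij). Qed.

Lemma lower_mulE A B i j : lower_tri A ->
  (A *s B) i j = \sum_(k < i.+1) A i k * B k j.
Proof. by move=> lA; apply: mul_smxE => k /lA ->; rewrite mul0r. Qed.

Lemma lower_tri_mul A B : lower_tri A -> lower_tri B -> lower_tri (A *s B).
Proof.
move=> lA lB i j ij; rewrite lower_mulE// big1// => k _.
by rewrite lB ?mulr0// (leq_ltn_trans _ ij)// -ltnS.
Qed.

Lemma lower_mul_diag A B i : lower_tri A -> lower_tri B ->
  (A *s B) i i = A i i * B i i.
Proof.
move=> lA lB; rewrite lower_mulE// big_ord_recr big1 /= => [|k _]; first by rewrite add0r.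
by rewrite lB ?mulr0.
Qed.

Lemma upper_tri_mul A B : upper_tri A -> upper_tri B -> upper_tri (A *s B).
Proof.
move=> uA uB i j ij; rewrite -[LHS]/(tr_smx (A *s B) j i) tr_mul_smx.
by apply: lower_tri_mul ij => k l kl; [apply: uB|apply: uA].
Qed.

Lemma upper_mul_diag A B i : upper_tri A -> upper_tri B ->
  (A *s B) i i = A i i * B i i.
Proof.
move=> uA uB; rewrite -[LHS]/(tr_smx (A *s B) i i) tr_mul_smx.
by rewrite mulrC lower_mul_diag// => k l kl; [apply: uB|apply: uA].
Qed.

(** * Leading submatrices, elimination and inverses of triangular matrices *)

Lemma leading_submx_mul A B n : lower_tri A ->
  leading_submx (A *s B) n = leading_submx A n *m leading_submx B n.
Proof.
move=> lA; apply/matrixP => i j; rewrite !mxE (mul_smxE n) => [|k nk].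
  by apply: eq_bigr => k _; rewrite !mxE.
by rewrite lA ?mul0r// (leq_trans (ltn_ord i)).
Qed.

Lemma det_leading_lower A n : lower_tri A ->
  \det (leading_submx A n) = \prod_(i < n) A i i.
Proof.
move=> lA; rewrite det_trig; first by apply: eq_bigr => i _; rewrite mxE.
by apply/is_trig_mxP => i j ij; rewrite mxE lA.
Qed.

Lemma det_leading_upper A n : upper_tri A ->
  \det (leading_submx A n) = \prod_(i < n) A i i.
Proof.
move=> uA; rewrite -det_tr.
rewrite -(@det_leading_lower (tr_smx A))//; last by move=> i j /uA.
by congr (\det _); apply/matrixP => i j; rewrite !mxE.
Qed.

Lemma leading_nonsingular_lower A :
  lower_tri A -> nonzero_diag A -> leading_nonsingular A.
Proof.
move=> lA nzA n; rewrite unitmxE det_leading_lower// unitfE.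
by apply/prodf_neq0 => i _; apply: nzA.
Qed.

(* Row [n] of [L] is the solution [v], supported on the indices up to [n], of
   [v A = 0] in the columns below [n], normalized by [v n = 1]. *)
Lemma gauss_elimination A : leading_nonsingular A -> exists L,
  [/\ lower_tri L, unit_diag L, upper_tri (L *s A) & nonzero_diag (L *s A)].
Proof.
move=> nsA.
pose v n : 'rV[K]_n := - (\row_k A n k) *m invmx (leading_submx A n).
(* [insub j] succeeds exactly when [j < n]. Row [n] is thus [v n] to the left of the diagonal and a
   row of the identity from the diagonal on. *)
pose L : smx K := fun n j => if insub j is Some j' then v n 0 j' else (j == n)%:R.
have Llt n (j : 'I_n) : L n j = v n 0 j.
  by rewrite /L insubT//= => jn; congr (v n 0 _); exact: val_inj.
have lL : lower_tri L.
  by move=> i j ij; rewrite /L insubN ?(gtn_eqF ij)// -leqNgt ltnW.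
have uL : unit_diag L by move=> i; rewrite /L insubN ?eqxx// ltnn.
have uLA : upper_tri (L *s A).
  move=> n j jn; rewrite lower_mulE// big_ord_recr/= uL mul1r.
  have <- : (v n *m leading_submx A n) 0 (Ordinal jn) = \sum_(k < n) L n k * A k j.
    by rewrite mxE; apply: eq_bigr => k _; rewrite Llt [X in _ * X]mxE.
  by rewrite mulmxKV// !mxE addNr.
exists L; split=> // i.
(* Since [L] is unitriangular, [L *s A] and [A] have the same leading minors. For [L *s A] these are
   products of diagonal entries, none of which can vanish. *)
have : \det (leading_submx (L *s A) i.+1) != 0.
  rewrite leading_submx_mul// det_mulmx det_leading_lower// big1// mul1r.
  by rewrite -unitfE -unitmxE.
rewrite det_leading_upper// => /prodf_neq0/(_ ord_max isT).
by [].
Qed.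

(** Eliminating in a matrix that is already lower triangular leaves one that is both lower and upper
    triangular, hence diagonal. Rescaling the rows of [L] then gives the inverse. *)
Lemma lower_left_inverse A : lower_tri A -> nonzero_diag A -> exists B,
  [/\ lower_tri B, nonzero_diag B & B *s A = one_smx K].
Proof.
move=> lA nzA.
have [L [lL uL uLA nzLA]] := gauss_elimination _ (leading_nonsingular_lower _ lA nzA).
set d := fun i => ((L *s A) i i)^-1.
have ld : lower_tri (diag_smx d).
  by move=> i j ij; rewrite /diag_smx (ltn_eqF ij) mul0r.
exists (diag_smx d *s L); split.
- exact: lower_tri_mul.
- by move=> i; rewrite mul_diag_smx uL mulr1 invr_eq0.
rewrite -mul_smxA_rr; [|exact: row_finite_lower..].
apply: smxP => i j; rewrite mul_diag_smx /one_smx.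
have [ij|ij|->] := ltngtP i j.
- by rewrite (lower_tri_mul _ _ lL lA) ?mulr0.
- by rewrite uLA ?mulr0.
- by rewrite mulVf.
Qed.

Lemma lower_inverse A : lower_tri A -> nonzero_diag A -> exists B,
  [/\ lower_tri B, nonzero_diag B, A *s B = one_smx K & B *s A = one_smx K].
Proof.
move=> lA nzA; have [B [lB nzB BA]] := lower_left_inverse _ lA nzA.
(* The left inverse [B] has a left inverse [C] in turn, and [C = C (B A) = (C B) A = A]. Hence [B]
   is two-sided. *)
have [C [lC _ CB]] := lower_left_inverse _ lB nzB.
exists B; split=> //; suff <- : C = A by [].
rewrite -[C]mulsmx1 -BA mul_smxA_rr ?CB ?mul1smx//; exact: row_finite_lower.
Qed.

Lemma upper_inverse A : upper_tri A -> nonzero_diag A -> exists B,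
  [/\ upper_tri B, nonzero_diag B, A *s B = one_smx K & B *s A = one_smx K].
Proof.
move=> uA nzA.
have lA : lower_tri (tr_smx A) by move=> i j /uA.
have [B [lB nzB AB BA]] := lower_inverse _ lA nzA.
exists (tr_smx B); split => //.
- by move=> i j /lB.
- by rewrite -[A]tr_smxK -tr_mul_smx BA tr_one_smx.
- by rewrite -[A]tr_smxK -tr_mul_smx AB tr_one_smx.
Qed.

Lemma inv_smx_spec A B : A *s B = one_smx K -> B *s A = one_smx K ->
  A *s inv_smx A = one_smx K /\ inv_smx A *s A = one_smx K.
Proof.
move=> AB BA; pose P : set (smx K) := [set X | A *s X = one_smx K /\ X *s A = one_smx K].
exact: (@xgetI _ A P B).
Qed.

(** Every right inverse [X] equals the triangular inverse [C], because [X = (C A) X = C (A X)]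
    regroups with [C] and [A] row-finite. This applies both to [B] and to the matrix that [xget]
    selects. *)
Lemma inv_smx_lower_eq A B : lower_tri A -> nonzero_diag A ->
  A *s B = one_smx K -> inv_smx A = B.
Proof.
move=> lA nzA AB; have [C [lC nzC AC CA]] := lower_inverse _ lA nzA.
have uniq X : A *s X = one_smx K -> X = C.
  move=> AX; rewrite -[X]mul1smx -CA -mul_smxA_rr ?AX ?mulsmx1//;
  exact: row_finite_lower.
rewrite (uniq _ AB); apply: uniq.
by have [] := @inv_smx_spec A C AC CA.
Qed.

Lemma inv_smx_upper_eq A B : upper_tri A -> nonzero_diag A ->
  B *s A = one_smx K -> inv_smx A = B.
Proof.
move=> uA nzA BA; have [C [uC nzC AC CA]] := upper_inverse _ uA nzA.
have uniq X : X *s A = one_smx K -> X = C.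
  move=> XA; rewrite -[X]mulsmx1 -AC mul_smxA_cc ?XA ?mul1smx//;
  exact: col_finite_upper.
rewrite (uniq _ BA); apply: uniq.
by have [] := @inv_smx_spec A C AC CA.
Qed.

Lemma inv_smx_lower A : lower_tri A -> nonzero_diag A ->
  [/\ lower_tri (inv_smx A), nonzero_diag (inv_smx A),
      A *s inv_smx A = one_smx K, inv_smx A *s A = one_smx K &
      inv_smx (inv_smx A) = A].
Proof.
move=> lA nzA; have [B [lB nzB AB BA]] := lower_inverse _ lA nzA.
by rewrite (inv_smx_lower_eq _ _ lA nzA AB) (inv_smx_lower_eq _ _ lB nzB BA).
Qed.

Lemma inv_smx_upper A : upper_tri A -> nonzero_diag A ->
  [/\ upper_tri (inv_smx A), nonzero_diag (inv_smx A),
      A *s inv_smx A = one_smx K, inv_smx A *s A = one_smx K &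
      inv_smx (inv_smx A) = A].
Proof.
move=> uA nzA; have [B [uB nzB AB BA]] := upper_inverse _ uA nzA.
by rewrite (inv_smx_upper_eq _ _ uA nzA BA) (inv_smx_upper_eq _ _ uB nzB AB).
Qed.

Lemma unit_nonzero_diag A : unit_diag A -> nonzero_diag A.
Proof. by move=> uA i; rewrite uA oner_neq0. Qed.

Lemma unit_diag_inv_lower A : lower_tri A -> unit_diag A -> unit_diag (inv_smx A).
Proof.
move=> lA uA i; have [lV _ AV _ _] := inv_smx_lower _ lA (unit_nonzero_diag _ uA).
by move: (lower_mul_diag _ _ i lA lV); rewrite AV uA mul1r => <-; rewrite /one_smx eqxx.
Qed.

Lemma unit_diag_inv_upper A : upper_tri A -> unit_diag A -> unit_diag (inv_smx A).
Proof.
move=> lA uA i; have [lV _ AV _ _] := inv_smx_upper _ lA (unit_nonzero_diag _ uA).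
by move: (upper_mul_diag _ _ i lA lV); rewrite AV uA mul1r => <-; rewrite /one_smx eqxx.
Qed.

(** * Uniqueness and existence of the LU, LDU and Gauss-Borel factorizations *)

Lemma lu_unique L1 L2 V1 V2 :
  lower_tri L1 -> unit_diag L1 -> lower_tri L2 -> unit_diag L2 ->
  upper_tri V1 -> nonzero_diag V1 -> upper_tri V2 ->
  L1 *s V1 = L2 *s V2 -> L1 = L2 /\ V1 = V2.
Proof.
move=> lL1 uL1 lL2 uL2 uV1 nzV1 uV2 E.
have [lI2 _ L2I I2L _] := inv_smx_lower _ lL2 (unit_nonzero_diag _ uL2).
have [uI1 _ V1I I1V _] := inv_smx_upper _ uV1 nzV1.
have uI2 := unit_diag_inv_lower _ lL2 uL2.
(* [X] equals both [L2^-1 L1] and [V2 V1^-1], so it is lower and upper triangular. Its diagonal is 1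
   by the first expression, so it is the identity. *)
set X := inv_smx L2 *s L1.
have lX : lower_tri X by exact: lower_tri_mul.
have XV : X *s V1 = V2.
  rewrite -mul_smxA_rr; [|exact: row_finite_lower..].
  rewrite E mul_smxA_rr; [|exact: row_finite_lower..].
  by rewrite I2L mul1smx.
have XE : X = V2 *s inv_smx V1.
  rewrite -XV -mul_smxA_rc ?V1I ?mulsmx1//; first exact: row_finite_lower.
  exact: col_finite_upper.
have X1 : X = one_smx K.
  apply: smxP => i j; rewrite /one_smx; have [ij|ij|->] := ltngtP i j.
  - exact: lX.
  - by rewrite XE upper_tri_mul.
  - by rewrite /X lower_mul_diag// uI2 uL1 mulr1.
split; last by rewrite -XV X1 mul1smx.
rewrite -[L1]mul1smx -L2I -mul_smxA_rr; [|exact: row_finite_lower..].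
by rewrite -/X X1 mulsmx1.
Qed.

Lemma lu_unique_right L1 L2 V1 V2 :
  upper_tri V1 -> unit_diag V1 -> upper_tri V2 -> unit_diag V2 ->
  lower_tri L1 -> nonzero_diag L1 -> lower_tri L2 ->
  L1 *s V1 = L2 *s V2 -> L1 = L2 /\ V1 = V2.
Proof.
move=> uV1 dV1 uV2 dV2 lL1 nzL1 lL2 E.
have [||||||||E1 E2] := lu_unique (tr_smx V1) (tr_smx V2) (tr_smx L1) (tr_smx L2) => //.
- by move=> i j /uV1.
- by move=> i j /uV2.
- by move=> i j /lL1.
- by move=> i j /lL2.
- by rewrite -(tr_mul_smx L1) -(tr_mul_smx L2) E.
by split; [rewrite -[L1]tr_smxK E2|rewrite -[V1]tr_smxK E1].
Qed.

(** Elimination gives [L A = V] with [V] upper triangular. Taking [D] as the diagonal of [V], one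
    has [A = L^-1 D (D^-1 V)], and [D^-1 V] is unitriangular. *)
Lemma ldu_exists A : leading_nonsingular A -> exists L D U,
  [/\ lower_tri L /\ unit_diag L, Defs.diagonal D /\ nonzero_diag D,
      upper_tri U /\ unit_diag U & A = L *s D *s U].
Proof.
move=> nsA; have [L [lL uL uLA nzLA]] := gauss_elimination _ nsA.
have [lI _ LI IL _] := inv_smx_lower _ lL (unit_nonzero_diag _ uL).
set d := fun i => (L *s A) i i.
exists (inv_smx L), (diag_smx d), (diag_smx (fun i => (d i)^-1) *s (L *s A)); split.
- by split=> //; exact: unit_diag_inv_lower.
- split=> [i j /negbTE ij|i]; rewrite /diag_smx ?ij ?mul0r//.
  by rewrite eqxx mul1r nzLA.
- split=> [i j ij|i]; rewrite mul_diag_smx; first by rewrite uLA ?mulr0.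
  by rewrite mulVf// nzLA.
rewrite -mul_smxA_rr.
- rewrite [X in inv_smx L *s X](_ : _ = L *s A); last first.
    by apply: smxP => i j; rewrite !mul_diag_smx mulrA divff ?mul1r ?nzLA.
  by rewrite mul_smxA_rr ?IL ?mul1smx//; exact: row_finite_lower.
- exact: row_finite_lower.
- by apply: row_finite_diag => i j /negbTE ij; rewrite /diag_smx ij mul0r.
Qed.

Lemma gauss_borel_leftP A : leading_nonsingular A ->
  let LU := gauss_borel_left A in
  [/\ lower_tri LU.1 /\ unit_diag LU.1, upper_tri LU.2 /\ nonzero_diag LU.2 &
      A = inv_smx LU.1 *s inv_smx LU.2].
Proof.
move=> /ldu_exists[L [D [U [[lL dL] [dD nzD] [uU dU] AE]]]].
have uD : upper_tri D by move=> i j ij; rewrite dD// (gtn_eqF ij).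
have uDU : upper_tri (D *s U) by exact: upper_tri_mul.
have nzDU : nonzero_diag (D *s U).
  by move=> i; rewrite upper_mul_diag// dU mulr1.
have [lI _ _ _ LII] := inv_smx_lower _ lL (unit_nonzero_diag _ dL).
have [uI nzI _ _ UII] := inv_smx_upper _ uDU nzDU.
rewrite /gauss_borel_left; set P := (X in xget _ X).
(* The diagonal factor is absorbed into the upper one, and both factors are inverted because the
   definition asks for [A = L^-1 U^-1]. *)
apply: (@xgetI _ _ P (inv_smx L, inv_smx (D *s U))); split=> //=.
- by split=> //; exact: unit_diag_inv_lower.
- rewrite LII UII mul_smxA_rr//; first exact: row_finite_lower.
  exact: row_finite_diag.
Qed.

Lemma gauss_borel_rightP A : leading_nonsingular A ->
  let LU := gauss_borel_right A in
  [/\ lower_tri LU.1 /\ nonzero_diag LU.1, upper_tri LU.2 /\ unit_diag LU.2 &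
      A = inv_smx LU.1 *s inv_smx LU.2].
Proof.
move=> /ldu_exists[L [D [U [[lL dL] [dD nzD] [uU dU] AE]]]].
have lD : lower_tri D by move=> i j ij; rewrite dD// (ltn_eqF ij).
have lLD : lower_tri (L *s D) by exact: lower_tri_mul.
have nzLD : nonzero_diag (L *s D).
  by move=> i; rewrite lower_mul_diag// dL mul1r.
have [lI nzI _ _ LII] := inv_smx_lower _ lLD nzLD.
have [uI _ _ _ UII] := inv_smx_upper _ uU (unit_nonzero_diag _ dU).
rewrite /gauss_borel_right; set P := (X in xget _ X).
apply: (@xgetI _ _ P (inv_smx (L *s D), inv_smx U)); split=> //=.
- by split=> //; exact: unit_diag_inv_upper.
- by rewrite LII UII.
Qed.

Lemma ldu_diagP A : leading_nonsingular A ->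
  (Defs.diagonal (ldu_diag A) /\ nonzero_diag (ldu_diag A)) /\
  exists L U, [/\ lower_tri L /\ unit_diag L, upper_tri U /\ unit_diag U &
                  A = L *s ldu_diag A *s U].
Proof.
move=> /ldu_exists[L [D [U [lL dD uU AE]]]].
rewrite /ldu_diag; set P := (X in xget _ X).
by apply: (@xgetI _ _ P D); split=> //; exists L, U.
Qed.

(** The lower factor of [A = L (D U)] identifies the left normalization, and both factors of
    [A = (L D) U] identify the right one. The second identity later yields the conjugation by [D]
    that relates [T_R] to [T_L]. *)
Lemma gauss_borel_ldu A : leading_nonsingular A ->
  A = inv_smx (gauss_borel_left A).1 *s ldu_diag A *s inv_smx (gauss_borel_right A).2 /\
  inv_smx (gauss_borel_right A).1 = inv_smx (gauss_borel_left A).1 *s ldu_diag A.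
Proof.
move=> nsA.
have [[dD nzD] [L [U [[lL dL] [uU dU] AE]]]] := ldu_diagP _ nsA.
have [[ll dl] [uu nzu] AEl] := gauss_borel_leftP _ nsA.
have [[lr nzr] [ur dr] AEr] := gauss_borel_rightP _ nsA.
have [lli _ _ _ _] := inv_smx_lower _ ll (unit_nonzero_diag _ dl).
have [uui nzui _ _ _] := inv_smx_upper _ uu nzu.
have [lri nzri _ _ _] := inv_smx_lower _ lr nzr.
have [uri _ _ _ _] := inv_smx_upper _ ur (unit_nonzero_diag _ dr).
have lD : lower_tri (ldu_diag A) by move=> i j ij; rewrite dD// (ltn_eqF ij).
have uD : upper_tri (ldu_diag A) by move=> i j ij; rewrite dD// (gtn_eqF ij).
have [||||||||-> _] := lu_unique (inv_smx (gauss_borel_left A).1) L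
  (inv_smx (gauss_borel_left A).2) (ldu_diag A *s U) => //.
- exact: unit_diag_inv_lower.
- exact: upper_tri_mul.
- by rewrite -AEl mul_smxA_rr//; exact: row_finite_lower.
have [||||||||-> ->] := lu_unique_right (inv_smx (gauss_borel_right A).1)
  (L *s ldu_diag A) (inv_smx (gauss_borel_right A).2) U => //.
- exact: unit_diag_inv_upper.
- exact: lower_tri_mul.
- by rewrite -AEr.
Qed.

(** The upper factor [V'] that accompanies the selected value is only known to be upper triangular.
    This is why [lu_unique] asks for a nonzero diagonal on one side alone. *)
Lemma hessenberg_L_eq L V :
  lower_tri L -> unit_diag L -> upper_tri V -> nonzero_diag V ->
  hessenberg_L (L *s V) = L.
Proof.
move=> lL dL uV nzV; rewrite /hessenberg_L; set P := (X in xget _ X).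
have [[lL' dL'] [V' uV' E]] : P (xget (one_smx K) P).
  by apply: (@xgetI _ _ P L); split=> //; exists V.
by have [] := lu_unique _ _ _ _ lL dL lL' dL' uV nzV uV' E.
Qed.

Lemma hessenberg_U_eq L V :
  upper_tri V -> unit_diag V -> lower_tri L -> nonzero_diag L ->
  hessenberg_U (L *s V) = V.
Proof.
move=> uV dV lL nzL; rewrite /hessenberg_U; set P := (X in xget _ X).
have [[uV' dV'] [L' lL' E]] : P (xget (one_smx K) P).
  by apply: (@xgetI _ _ P V); split=> //; exists L.
by have [] := lu_unique_right _ _ _ _ uV dV uV' dV' lL nzL lL' E.
Qed.

(** * Products with powers of the shift matrix *)

Local Notation Lambda := (shift_smx K).

Lemma row_finite_shift : row_finite Lambda.
Proof. by move=> i; exists i.+2 => k ik; rewrite /shift_smx (gtn_eqF ik). Qed.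

Lemma row_finite_shift_exp n : row_finite (exp_smx Lambda n).
Proof.
elim: n => [|n IHn]; first exact/row_finite_lower/lower_tri_one.
by apply: row_finite_mul => //; exact: row_finite_shift.
Qed.

Lemma mul_shift A i j : (Lambda *s A) i j = A i.+1 j.
Proof.
rewrite (mul_smxE i.+2) => [|k ik]; last by rewrite /shift_smx (gtn_eqF ik) mul0r.
rewrite big_ord_recr big1 /= => [|k _].
  by rewrite /shift_smx eqxx mul1r add0r.
by rewrite /shift_smx (ltn_eqF (ltn_ord k)) mul0r.
Qed.

Lemma mul_shift_exp n A i j : (exp_smx Lambda n *s A) i j = A (i + n)%N j.
Proof.
elim: n i => [|n IHn] i; first by rewrite mul1smx addn0.
rewrite /exp_smx iterS -/(exp_smx Lambda n) -mul_smxA_rr.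
- by rewrite mul_shift IHn addSnnS.
- exact: row_finite_shift.
- exact: row_finite_shift_exp.
Qed.

Lemma mul_tr_shift A i j : (A *s tr_smx Lambda) i j = A i j.+1.
Proof.
by rewrite -[LHS]/(tr_smx (A *s tr_smx Lambda) j i) tr_mul_smx mul_shift.
Qed.

Lemma mul_tr_shift_exp n A i j : (A *s tr_smx (exp_smx Lambda n)) i j = A i (j + n)%N.
Proof.
rewrite -[LHS]/(tr_smx (A *s tr_smx (exp_smx Lambda n)) j i) tr_mul_smx.
exact: mul_shift_exp.
Qed.

(** * Ordered products and their conjugates *)

Lemma prod_incrS (F : nat -> smx K) n : prod_incr F n.+1 = prod_incr F n *s F n.+1.
Proof. by rewrite /prod_incr -[in iota _ _](addn1 n) iotaD map_cat foldl_cat /= add1n. Qed.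

Lemma row_finite_prod_incr (F : nat -> smx K) n :
  (forall k, (0 < k)%N -> row_finite (F k)) -> row_finite (prod_incr F n).
Proof.
move=> rfF; elim: n => [|n IHn]; first exact/row_finite_lower/lower_tri_one.
by rewrite prod_incrS; apply: row_finite_mul => //; exact: rfF.
Qed.

Lemma prod_incr_conj (F : nat -> smx K) A B n :
  (forall k, (0 < k)%N -> row_finite (F k)) -> row_finite A -> row_finite B ->
  A *s B = one_smx K -> B *s A = one_smx K ->
  prod_incr (fun k => B *s F k *s A) n = B *s prod_incr F n *s A.
Proof.
move=> rfF rfA rfB AB BA; elim: n => [|n IHn]; first by rewrite mulsmx1.
have rfP := row_finite_prod_incr F n rfF; have rfFn := rfF _ (ltn0Sn n).
have rfBP := row_finite_mul _ _ rfB rfP.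
have rfBF := row_finite_mul _ _ rfB rfFn.
rewrite !prod_incrS IHn -(mul_smxA_rr (B *s prod_incr F n))// (mul_smxA_rr A)//.
rewrite (mul_smxA_rr A B)// AB mul1smx (mul_smxA_rr (B *s prod_incr F n))//.
by rewrite (mul_smxA_rr B).
Qed.

(** In [prod_decr] the factor of largest index is the first one folded in. To peel it off, the
    accumulator has to be moved out to the left, a regrouping allowed by the column-finiteness of
    upper triangular factors. *)
Lemma foldl_upper (F : nat -> smx K) A (s : seq nat) :
  {in s, forall k, upper_tri (F k)} ->
  foldl (@mul_smx K) A [seq F k | k <- s] =
    A *s foldl (@mul_smx K) (one_smx K) [seq F k | k <- s] /\
  upper_tri (foldl (@mul_smx K) (one_smx K) [seq F k | k <- s]).
Proof.
elim: s A => [|k s IHs] A us /=.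
  by rewrite mulsmx1; split=> // i j ij; rewrite /one_smx (gtn_eqF ij).
have uk : upper_tri (F k) by apply: us; rewrite mem_head.
have {}IHs X := IHs X (fun l sl => us l (mem_behead (s := k :: s) sl)).
have [-> uF] := IHs (A *s F k).
have [-> _] := IHs (one_smx K *s F k); rewrite mul1smx.
split; last exact: upper_tri_mul.
by rewrite mul_smxA_cc//; exact: col_finite_upper.
Qed.

Lemma prod_decrS (F : nat -> smx K) n :
  (forall k, (0 < k)%N -> upper_tri (F k)) ->
  prod_decr F n.+1 = F n.+1 *s prod_decr F n /\ upper_tri (prod_decr F n.+1).
Proof.
move=> uF; rewrite /prod_decr -[in iota _ _](addn1 n) iotaD rev_cat /=.
rewrite add1n mul1smx.
have us : {in rev (iota 1 n), forall k, upper_tri (F k)}.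
  by move=> k; rewrite mem_rev mem_iota => /andP[k0 _]; exact: uF.
have [-> uP] := foldl_upper F (F n.+1) _ us.
by split=> //; apply: upper_tri_mul => //; exact: uF.
Qed.

Lemma upper_prod_decr (F : nat -> smx K) n :
  (forall k, (0 < k)%N -> upper_tri (F k)) -> upper_tri (prod_decr F n).
Proof.
move=> uF; case: n => [|n]; last by have [] := prod_decrS F n uF.
by move=> i j ij; rewrite /prod_decr /= /one_smx (gtn_eqF ij).
Qed.

Lemma prod_decr_conj (F : nat -> smx K) A B n :
  (forall k, (0 < k)%N -> upper_tri (F k)) -> upper_tri A -> upper_tri B ->
  A *s B = one_smx K -> B *s A = one_smx K ->
  prod_decr (fun k => B *s F k *s A) n = B *s prod_decr F n *s A.
Proof.
move=> uF uA uB AB BA; elim: n => [|n IHn]; first by rewrite mulsmx1.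
have uP := upper_prod_decr F n uF; have uFn := uF _ (ltn0Sn n).
have uG k : (0 < k)%N -> upper_tri (B *s F k *s A).
  by move=> k0; do 2?apply: upper_tri_mul => //; exact: uF.
have [-> _] := prod_decrS _ n uF; have [-> _] := prod_decrS _ n uG.
have cf X : upper_tri X -> col_finite X := @col_finite_upper X.
rewrite IHn (mul_smxA_cc _ (B *s prod_decr F n)); [|exact/cf/upper_tri_mul|exact: cf].
rewrite (mul_smxA_cc _ B); [|exact: cf..].
rewrite -(mul_smxA_cc _ A); [|exact: cf..].
by rewrite AB mulsmx1 (mul_smxA_cc B); [|exact: cf..].
Qed.

End SemiInfinite.

(** * Gauss-Borel factors of the Christoffel perturbations *)

Section Christoffel.
Variables (K : fieldType) (M : smx K).
Hypothesis nsM : forall k, leading_nonsingular (christoffel_left M k) /\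
  leading_nonsingular (christoffel_right M k).
Local Notation Lambda := (shift_smx K).

Lemma calL_leftP k : lower_tri (calL_left M k) /\ unit_diag (calL_left M k).
Proof. by have [] := gauss_borel_leftP K _ (nsM k).1. Qed.

Lemma calU_leftP k : upper_tri (calU_left M k) /\ nonzero_diag (calU_left M k).
Proof. by have [] := gauss_borel_leftP K _ (nsM k).1. Qed.

Lemma christoffel_leftE k :
  christoffel_left M k = inv_smx (calL_left M k) *s inv_smx (calU_left M k).
Proof. by have [] := gauss_borel_leftP K _ (nsM k).1. Qed.

Lemma calL_rightP k : lower_tri (calL_right M k) /\ nonzero_diag (calL_right M k).
Proof. by have [] := gauss_borel_rightP K _ (nsM k).2. Qed.

Lemma calU_rightP k : upper_tri (calU_right M k) /\ unit_diag (calU_right M k).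
Proof. by have [] := gauss_borel_rightP K _ (nsM k).2. Qed.

Lemma christoffel_rightE k :
  christoffel_right M k = inv_smx (calL_right M k) *s inv_smx (calU_right M k).
Proof. by have [] := gauss_borel_rightP K _ (nsM k).2. Qed.

Lemma inv_calL_left k : let L := calL_left M k in
  [/\ lower_tri (inv_smx L), unit_diag (inv_smx L),
      L *s inv_smx L = one_smx K & inv_smx L *s L = one_smx K].
Proof.
have [lL dL] := calL_leftP k.
have [? _ ? ? _] := inv_smx_lower _ _ lL (unit_nonzero_diag _ _ dL).
by split=> //; exact: unit_diag_inv_lower.
Qed.

Lemma inv_calU_left k : let U := calU_left M k in
  [/\ upper_tri (inv_smx U), nonzero_diag (inv_smx U),
      U *s inv_smx U = one_smx K & inv_smx U *s U = one_smx K].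
Proof. by have [lU dU] := calU_leftP k; have [] := inv_smx_upper _ _ lU dU. Qed.

Lemma inv_calL_right k : let L := calL_right M k in
  [/\ lower_tri (inv_smx L), nonzero_diag (inv_smx L),
      L *s inv_smx L = one_smx K & inv_smx L *s L = one_smx K].
Proof. by have [lL dL] := calL_rightP k; have [] := inv_smx_lower _ _ lL dL. Qed.

Lemma inv_calU_right k : let U := calU_right M k in
  [/\ upper_tri (inv_smx U), unit_diag (inv_smx U),
      U *s inv_smx U = one_smx K & inv_smx U *s U = one_smx K].
Proof.
have [lU dU] := calU_rightP k.
have [? _ ? ? _] := inv_smx_upper _ _ lU (unit_nonzero_diag _ _ dU).
by split=> //; exact: unit_diag_inv_upper.
Qed.

(** * Consecutive perturbations and the bidiagonal connection matrices *)

Lemma christoffel_leftS k :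
  christoffel_left M k.+1 = christoffel_left M k *s tr_smx Lambda.
Proof.
by apply: smxP => i j; rewrite /christoffel_left mul_tr_shift !mul_tr_shift_exp addSnnS.
Qed.

Lemma christoffel_rightS k :
  christoffel_right M k.+1 = Lambda *s christoffel_right M k.
Proof. by apply: smxP => i j; rewrite /christoffel_right mul_shift !mul_shift_exp addSnnS. Qed.

Lemma christoffel_left0 : christoffel_left M 0 = M.
Proof. by apply: smxP => i j; rewrite /christoffel_left mul_tr_shift_exp addn0. Qed.

Lemma christoffel_right0 : christoffel_right M 0 = M.
Proof. by apply: smxP => i j; rewrite /christoffel_right mul_shift_exp addn0. Qed.

Lemma col_finite_tr_shift : col_finite K (tr_smx Lambda).
Proof. exact: row_finite_shift. Qed.

(* [fin] settles the finiteness conditions left by each regrouping, starting from the triangularity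
   facts in the context. This is why the proofs below first collect such facts. *)
Hint Resolve row_finite_lower col_finite_upper row_finite_shift
  row_finite_shift_exp col_finite_tr_shift row_finite_diag col_finite_diag
  row_finite_mul col_finite_mul : smx.
Local Ltac fin := eauto 6 with smx.

(** The factor [inv_smx (calU_left M k)] is [calL_left M k] times the k-th perturbation, and a
    further [Lambda^T] gives the next perturbation. Factoring that one displays the Hessenberg
    matrix as unitriangular times upper triangular. *)
Lemma inv_calU_left_shift k : inv_smx (calU_left M k) *s tr_smx Lambda =
  calL_left M k *s inv_smx (calL_left M k.+1) *s inv_smx (calU_left M k.+1).
Proof.
have [lL _] := calL_leftP k; have [lI _ LI _] := inv_calL_left k.
have [lI' _ _ _] := inv_calL_left k.+1.
rewrite -mul_smxA_rr; [|by fin..].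
rewrite -christoffel_leftE christoffel_leftS mul_smxA_rc; [|by fin..].
by rewrite christoffel_leftE mul_smxA_rr; [rewrite LI mul1smx|fin|fin].
Qed.

Lemma shift_inv_calL_right k : Lambda *s inv_smx (calL_right M k) =
  inv_smx (calL_right M k.+1) *s (inv_smx (calU_right M k.+1) *s calU_right M k).
Proof.
have [uU _] := calU_rightP k; have [uI _ _ IU] := inv_calU_right k.
have [uI' _ _ _] := inv_calU_right k.+1.
rewrite mul_smxA_cc; [|by fin..].
rewrite -christoffel_rightE christoffel_rightS -mul_smxA_rc; [|by fin..].
by rewrite christoffel_rightE -mul_smxA_cc; [rewrite IU mulsmx1|fin|fin].
Qed.

Lemma christoffel_LE k :
  christoffel_L M k.+1 = calL_left M k *s inv_smx (calL_left M k.+1).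
Proof.
have [lL dL] := calL_leftP k; have [lI dI _ _] := inv_calL_left k.+1.
have [uU nzU _ _] := inv_calU_left k.+1.
rewrite /christoffel_L inv_calU_left_shift hessenberg_L_eq//.
  exact: lower_tri_mul.
by move=> i; rewrite lower_mul_diag// dL dI mulr1.
Qed.

Lemma christoffel_UE k :
  christoffel_U M k.+1 = inv_smx (calU_right M k.+1) *s calU_right M k.
Proof.
have [uU dU] := calU_rightP k; have [uI dI _ _] := inv_calU_right k.+1.
have [lL nzL _ _] := inv_calL_right k.+1.
rewrite /christoffel_U shift_inv_calL_right hessenberg_U_eq//.
  exact: upper_tri_mul.
by move=> i; rewrite upper_mul_diag// dU dI mulr1.
Qed.

Lemma christoffel_LP k : (0 < k)%N ->
  lower_bidiagonal (christoffel_L M k) /\ unit_diag (christoffel_L M k).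
Proof.
case: k => // k _; rewrite christoffel_LE.
have [lL dL] := calL_leftP k; have [lI dI _ _] := inv_calL_left k.+1.
have [uI _ _ _] := inv_calU_left k.
have [uU _] := calU_leftP k.+1; have [uI' _ _ IU] := inv_calU_left k.+1.
split; last by move=> i; rewrite lower_mul_diag// dL dI mulr1.
move=> i j ij ij1; have [{}ij|{ij ij1}ji] : (i < j)%N \/ (j.+1 < i)%N by lia.
  exact: lower_tri_mul ij.
(* The second expression for the same matrix is upper Hessenberg, so it vanishes below the first
   subdiagonal. *)
have -> : calL_left M k *s inv_smx (calL_left M k.+1) =
    inv_smx (calU_left M k) *s tr_smx Lambda *s calU_left M k.+1.
  rewrite inv_calU_left_shift -mul_smxA_cc; [|by fin..].
  by rewrite IU mulsmx1.
rewrite (mul_smxE _ j.+1) => [|l jl]; last by rewrite uU ?mulr0.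
(* The shift moves the column index to [l + 1], which is at most [j + 1] and hence less than [i]. *)
rewrite big1// => l _; rewrite mul_tr_shift uI ?mul0r//.
by rewrite (leq_ltn_trans _ ji)// ltnS.
Qed.

Lemma christoffel_UP k : (0 < k)%N ->
  upper_bidiagonal (christoffel_U M k) /\ unit_diag (christoffel_U M k).
Proof.
case: k => // k _; rewrite christoffel_UE.
have [uU dU] := calU_rightP k; have [uI dI _ _] := inv_calU_right k.+1.
have [lI _ _ _] := inv_calL_right k.
have [lL _] := calL_rightP k.+1; have [lI' _ LI _] := inv_calL_right k.+1.
split; last by move=> i; rewrite upper_mul_diag// dU dI mulr1.
move=> i j ij ij1; have [{}ij|{ij ij1}ji] : (j < i)%N \/ (i.+1 < j)%N by lia.
  exact: upper_tri_mul ij.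
(* Dually, this expression is lower Hessenberg and vanishes above the first superdiagonal. *)
have -> : inv_smx (calU_right M k.+1) *s calU_right M k =
    calL_right M k.+1 *s (Lambda *s inv_smx (calL_right M k)).
  rewrite shift_inv_calL_right mul_smxA_rr; [|by fin..].
  by rewrite LI mul1smx.
rewrite lower_mulE// big1// => l _; rewrite mul_shift lI ?mulr0//.
by rewrite (leq_ltn_trans _ ji)// ltnS.
Qed.

Lemma prod_christoffel_L n :
  prod_incr (christoffel_L M) n = calL_left M 0 *s inv_smx (calL_left M n).
Proof.
elim: n => [|n IHn]; first by have [] := inv_calL_left 0.
have [lL _] := calL_leftP n; have [lI _ _ IL] := inv_calL_left n.
have [lL0 _] := calL_leftP 0; have [lI' _ _ _] := inv_calL_left n.+1.
rewrite prod_incrS IHn christoffel_LE -mul_smxA_rr; [|by fin..].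
by rewrite [X in _ *s X]mul_smxA_rr; [rewrite IL mul1smx|fin|fin].
Qed.

Lemma upper_christoffel_U k : (0 < k)%N -> upper_tri (christoffel_U M k).
Proof.
case: k => // k _; rewrite christoffel_UE; apply: upper_tri_mul.
  by have [] := inv_calU_right k.+1.
by have [] := calU_rightP k.
Qed.

Lemma prod_christoffel_U n :
  prod_decr (christoffel_U M) n = inv_smx (calU_right M n) *s calU_right M 0.
Proof.
elim: n => [|n IHn]; first by have [] := inv_calU_right 0.
have [uU _] := calU_rightP n; have [uI _ UI _] := inv_calU_right n.
have [uU0 _] := calU_rightP 0; have [uI' _ _ _] := inv_calU_right n.+1.
have [-> _] := prod_decrS _ _ n upper_christoffel_U.
rewrite IHn christoffel_UE mul_smxA_cc; [|by fin..].
rewrite -[X in X *s _]mul_smxA_cc; [|by fin..].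
by rewrite UI mulsmx1.
Qed.

Lemma calD_leftP k : Defs.diagonal (calD_left M k) /\ nonzero_diag (calD_left M k).
Proof. by have [] := ldu_diagP K _ (nsM k).1. Qed.

(** * The bidiagonal factorizations *)

Variables p q : nat.
Hypothesis shiftM : christoffel_right M q = christoffel_left M p.

Let D := ldu_diag M.
Let P := prod_incr (christoffel_L M) p.
Let Q := prod_decr (christoffel_U M) q.

Lemma ldu_diag_moment : [/\ Defs.diagonal D, nonzero_diag D,
  M = inv_smx (calL_left M 0) *s D *s inv_smx (calU_right M 0) &
  inv_smx (calL_right M 0) = inv_smx (calL_left M 0) *s D].
Proof.
have [dD nzD] := calD_leftP 0.
have [ME LE] := gauss_borel_ldu K _ (nsM 0).1.
rewrite /calL_left /calL_right /calU_right /D christoffel_right0.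
by move: dD nzD ME LE; rewrite /calD_left christoffel_left0.
Qed.

Lemma inv_ldu_diag : [/\ Defs.diagonal (inv_smx D), D *s inv_smx D = one_smx K &
  inv_smx D *s D = one_smx K].
Proof.
have [dD nzD _ _] := ldu_diag_moment.
have lD : lower_tri D by move=> i j ij; rewrite dD// (ltn_eqF ij).
have uD : upper_tri D by move=> i j ij; rewrite dD// (gtn_eqF ij).
have [lI _ DI ID _] := inv_smx_lower _ _ lD nzD.
have [uI _ _ _ _] := inv_smx_upper _ _ uD nzD.
by split=> // i j; rewrite neq_ltn => /orP[/lI|/uI].
Qed.

(** The product [T_L D] stands between the two normalizations: [D^-1] on its right gives [T_L], and
    [D^-1] on its left gives [T_R]. Both factorizations are therefore read off from this
    identity. *)
Lemma recurrence_left_mul_diag :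
  recurrence_left M q *s D = P *s calD_left M p *s Q.
Proof.
have [dD _ ME _] := ldu_diag_moment; have [dDp _] := calD_leftP p.
have [lL _] := calL_leftP 0; have [lI _ LI _] := inv_calL_left 0.
have [lIp _ _ _] := inv_calL_left p.
have [uU _] := calU_rightP 0; have [uI _ _ IU] := inv_calU_right 0.
have [uIq _ _ _] := inv_calU_right q.
(* By [shiftM] the upper factor of the p-th left perturbation is that of the q-th right one, which
   is where the product of the [U_k] ends. *)
have MpE : christoffel_left M p =
    inv_smx (calL_left M p) *s calD_left M p *s inv_smx (calU_right M q).
  have [E _] := gauss_borel_ldu K _ (nsM p).1.
  by rewrite {1}E /calU_right shiftM.
have TE : recurrence_left M q =
    calL_left M 0 *s exp_smx Lambda q *s inv_smx (calL_left M 0).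
  by rewrite /recurrence_left /calL_left christoffel_left0.
have rfT : row_finite K (calL_left M 0 *s exp_smx Lambda q) by fin.
rewrite /P /Q prod_christoffel_L prod_christoffel_U.
(* Inserting [calU_right^-1 calU_right] at index 0 completes [calL_left^-1 D] to [M]. *)
have -> : recurrence_left M q *s D =
    calL_left M 0 *s exp_smx Lambda q *s M *s calU_right M 0.
  rewrite [X in _ = _ *s X *s _]ME TE.
  rewrite -[in RHS](mul_smxA_rc _ (calL_left M 0 *s exp_smx Lambda q)); [|by fin..].
  rewrite -[X in _ = _ *s X]mul_smxA_cc; [|by fin..].
  by rewrite IU mulsmx1 mul_smxA_rr; [|by fin..].
rewrite -[X in X *s _ = _]mul_smxA_rr; [|by fin..].
rewrite -/(christoffel_right M q) shiftM MpE.
rewrite -mul_smxA_rc; [|by fin..].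
rewrite -[X in _ *s X = _]mul_smxA_cc; [|by fin..].
rewrite (mul_smxA_rr _ (calL_left M 0)); [|by fin..].
by rewrite (mul_smxA_rr _ (calL_left M 0)); [|by fin..].
Qed.

Lemma row_finite_prod_L : row_finite K P.
Proof.
have [lL _] := calL_leftP 0; have [lI _ _ _] := inv_calL_left p.
by rewrite /P prod_christoffel_L; fin.
Qed.

Lemma upper_tri_diag (A : smx K) : Defs.diagonal A -> upper_tri A.
Proof. by move=> dA i j ij; rewrite dA// (gtn_eqF ij). Qed.

Lemma recurrence_left_factorization :
  recurrence_left M q = P *s calD_left M p *s inv_smx D *s
    prod_decr (fun k => D *s christoffel_U M k *s inv_smx D) q.
Proof.
have [dD _ _ _] := ldu_diag_moment; have [dI DI ID] := inv_ldu_diag.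
have [dDp _] := calD_leftP p; have rfP := row_finite_prod_L.
have uQ : upper_tri Q := upper_prod_decr _ _ q upper_christoffel_U.
(* The product of the conjugated factors is [D Q D^-1], whose leading [D] cancels the [D^-1] before
   it. *)
rewrite (prod_decr_conj _ _ _ _ q upper_christoffel_U (upper_tri_diag _ dI)
  (upper_tri_diag _ dD) ID DI) -/Q.
rewrite -mul_smxA_rr; [|by fin..].
rewrite (mul_smxA_rc _ (inv_smx D)); [|by fin..].
rewrite (mul_smxA_rr _ (inv_smx D)); [|by fin..].
rewrite ID mul1smx mul_smxA_rc; [|by fin..].
by rewrite -recurrence_left_mul_diag -mul_smxA_cc; [rewrite DI mulsmx1|fin|fin].
Qed.

Lemma recurrence_right_factorization :
  recurrence_right M q =
    prod_incr (fun k => inv_smx D *s christoffel_L M k *s D) p *s inv_smx D *s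
    calD_right M q *s Q.
Proof.
have [dD _ _ LE] := ldu_diag_moment; have [dI DI ID] := inv_ldu_diag.
have [dDp _] := calD_leftP p; have rfP := row_finite_prod_L.
have [lL _] := calL_leftP 0; have [lI _ LI IL] := inv_calL_left 0.
have [lR nzR] := calL_rightP 0.
(* Inverting [calL_right^-1 = calL_left^-1 D] gives this relation, from which [T_R = D^-1 T_L D]. *)
have RE : calL_right M 0 = inv_smx D *s calL_left M 0.
  have [lRI nzRI _ _ <-] := inv_smx_lower _ _ lR nzR.
  apply: inv_smx_lower_eq => //; rewrite LE.
  rewrite -mul_smxA_rr; [|by fin..].
  rewrite (mul_smxA_rr _ D); [|by fin..].
  by rewrite DI mul1smx.
have -> : recurrence_right M q = inv_smx D *s (recurrence_left M q *s D).
  rewrite /recurrence_right /recurrence_left -{1 2}[M]christoffel_right0.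
  rewrite -[M in gauss_borel_left M]christoffel_left0.
  rewrite -/(calL_left M 0) -/(calL_right M 0) LE RE.
  rewrite -[X in _ = _ *s X]mul_smxA_rr; [|by fin..].
  rewrite [RHS]mul_smxA_rr; [|by fin..].
  by rewrite (mul_smxA_rr _ (inv_smx D)); [|by fin..].
have rfL k : (0 < k)%N -> row_finite K (christoffel_L M k).
  case: k => // k _; rewrite christoffel_LE.
  by have [? _] := calL_leftP k; have [? _ _ _] := inv_calL_left k.+1; fin.
rewrite prod_incr_conj//; [|by fin..].
(* The two perturbed matrices coincide by [shiftM], so [D_R^(q)] is [D_L^(p)]. *)
rewrite -/P recurrence_left_mul_diag /calD_right shiftM -/(calD_left M p).
rewrite -(mul_smxA_rr _ _ D (inv_smx D)); [|by fin..].
rewrite DI mulsmx1 -(mul_smxA_rr _ (inv_smx D) P); [|by fin..].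
by rewrite -[RHS]mul_smxA_rr; [|by fin..].
Qed.

End Christoffel.

(** * The shift symmetry of moment matrices and the theorem *)

Lemma block_monomialsD (R : realType) (r : nat) (x : R) (n : nat) (c : 'I_r) :
  block_monomials x (n + r) c = block_monomials x n c * x.
Proof.
(* The index [c] forces [r > 0]. Adding [r] to [n] then keeps the residue and raises the quotient by
   one, which yields the factor [x]. *)
have r0 : (0 < r)%N by rewrite (leq_ltn_trans _ (ltn_ord c)).
by rewrite /block_monomials modnDr divnDr// divnn r0 addn1 exprSr mulrA.
Qed.

(** Shifting the row by [q] or the column by [p] multiplies the integrand by the same factor [x], so
    the entries agree already under the integral sign. *)
Lemma moment_smx_shift (R : realType) (p q : nat)
    (Delta : set (measurableTypeR R))
    (mu : 'I_q -> 'I_p -> {measure set (measurableTypeR R) -> \bar R}) :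
  christoffel_right (moment_smx Delta mu) q = christoffel_left (moment_smx Delta mu) p.
Proof.
apply: smxP => n m; rewrite /christoffel_right /christoffel_left.
rewrite mul_shift_exp mul_tr_shift_exp.
apply: eq_bigr => b _; apply: eq_bigr => a _; apply: eq_Rintegral => x _.
by rewrite !block_monomialsD mulrAC mulrA.
Qed.

Theorem theorem2p2 (R : realType) (p q : nat)
    (p_gt0 : (0 < p)%N) (q_gt0 : (0 < q)%N)
    (Delta : set (measurableTypeR R)) (mDelta : measurable Delta)
    (mu : 'I_q -> 'I_p -> {measure set (measurableTypeR R) -> \bar R})
    (mu_supp : forall b a, mu b a (~` Delta) = 0%E)
    (mu_moments : forall b a (n : nat),
       (mu b a).-integrable Delta (fun x : R => (x ^+ n)%:E)) :
  let M : smx R := moment_smx Delta mu in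
  (forall k : nat, leading_nonsingular (christoffel_left M k) /\
                   leading_nonsingular (christoffel_right M k)) ->
  let D := ldu_diag M in
  let L := christoffel_L M in
  let U := christoffel_U M in
  let Ltilde := fun k : nat => inv_smx D *s L k *s D in
  let Utilde := fun k : nat => D *s U k *s inv_smx D in
  [/\ forall k : nat, (0 < k)%N -> lower_bidiagonal (L k) /\ unit_diag (L k),
      forall k : nat, (0 < k)%N -> upper_bidiagonal (U k) /\ unit_diag (U k),
      recurrence_left M q =
        prod_incr L p *s calD_left M p *s inv_smx D *s prod_decr Utilde q &
      recurrence_right M q =
        prod_incr Ltilde p *s inv_smx D *s calD_right M q *s prod_decr U q].
Proof.
move=> M nsM D L U Ltilde Utilde.
have shiftM := moment_smx_shift R p q Delta mu.
split.
- exact: christoffel_LP.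
- exact: christoffel_UP.
- exact: recurrence_left_factorization.
- exact: recurrence_right_factorization.
Qed.
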